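(* For every integer $n\ge 1$ with $n\not\equiv 0 \pmod 4$, let $E(n)=F(n)-F_1(n)$ (counted with the weights described in the context). Then $$E(n)=\begin{cases} H(4n), & n\equiv 1,2 \pmod 4,\\ 2H(n), & n\equiv 3\pmod 8,\\ 0, & n\equiv 7 \pmod 8.\end{cases}$$
   Context: A classical binary quadratic form is written $(a,2b,c)$ and denotes $ax^2+2bxy+cy^2$ with $a,b,c\in\mathbb Z$; its determinant is $D=b^2-ac$. Only positive definite forms ($a>0$, $D<0$) are considered, and two forms are equivalent if one is obtained from the other by a change of variables in $SL_2(\mathbb Z)$. The divisor of $(a,2b,c)$ is $\delta=\gcd(a,b,c)$; the form is primitive if $\delta=1$ and derived otherwise. A primitive form $(a,2b,c)$ is uneven if $a$ and $c$ are not both even, and even otherwise; a derived form of divisor $\delta$ is uneven (resp. even) when $(a/\delta,2b/\delta,c/\delta)$ is uneven (resp. even). For $n>0$, $F(n)$ (resp. $F_1(n)$) is the number of equivalence classes of uneven (resp. even) forms, primitive or derived, of determinant $-n$, where each class of $(t,2\cdot 0,t)$ ($t\ge1$, i.e. the class of $(1,2\cdot0,1)$ or derived from it) is counted with weight $1/2$, each class of $(2t,2\cdot t,2t)$ ($t\ge 1$, i.e. the class of $(2,2\cdot1,2)$ or derived from it) is counted with weight $1/3$, and all other classes with weight $1$. For a negative integer $\Delta\equiv 0,1\pmod 4$, $h(\Delta)$ denotes the number of $SL_2(\mathbb Z)$-classes of primitive positive definite forms $ax^2+bxy+cy^2$ with $b^2-4ac=\Delta$; set $h_\omega(\Delta)=h(\Delta)$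 if $\Delta<-4$, $h_\omega(-4)=1/2$, $h_\omega(-3)=1/3$. For such $\Delta$, write $\Delta=f^2\Delta_1$ with $\Delta_1$ a fundamental discriminant and $f\ge1$; the Hurwitz class number is $H(|\Delta|)=\sum_{t\mid f} h_\omega(\Delta/t^2)$. *)

(* Defs.v *)
From HB Require Import structures.
From Stdlib Require Import ClassicalEpsilon.
From mathcomp Require Import all_boot all_order all_algebra.
Set Implicit Arguments. Unset Strict Implicit. Unset Printing Implicit Defensive.
Import Order.TTheory GRing.Theory Num.Theory.
Local Open Scope ring_scope.

(* A form is a triple of integers.  For classical forms the triple (a,b,c)
   denotes a x^2 + 2 b x y + c y^2 (written (a,2b,c) in the paper);
   for Gauss-discriminant forms the triple (a,b,c) denotes a x^2 + b x y + c y^2. *)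
Definition form := (int * int * int)%type.
Definition fa (f : form) : int := f.1.1.
Definition fb (f : form) : int := f.1.2.
Definition fc (f : form) : int := f.2.

(* substitution x -> p x + q y, y -> r x + s y in a x^2 + 2 b x y + c y^2 *)
Definition act_cl (f : form) (p q r s : int) : form :=
  let a := fa f in let b := fb f in let c := fc f in
  (a * p ^+ 2 + 2 * b * p * r + c * r ^+ 2,
   a * p * q + b * (p * s + q * r) + c * r * s,
   a * q ^+ 2 + 2 * b * q * s + c * s ^+ 2).

(* substitution x -> p x + q y, y -> r x + s y in a x^2 + b x y + c y^2 *)
Definition act_g (f : form) (p q r s : int) : form :=
  let a := fa f in let b := fb f in let c := fc f in
  (a * p ^+ 2 + b * p * r + c * r ^+ 2,
   2 * a * p * q + b * (p * s + q * r) + 2 * c * r * s,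
   a * q ^+ 2 + b * q * s + c * s ^+ 2).

Definition equiv_by (act : form -> int -> int -> int -> int -> form)
  (f g : form) : Prop :=
  exists p q r s : int, p * s - q * r = 1 /\ act f p q r s = g.

Definition equiv_cl := equiv_by act_cl.
Definition equiv_g := equiv_by act_g.

Definition rep_system (E : form -> form -> Prop) (P : form -> Prop)
  (L : seq form) : Prop :=
  [/\ forall x, x \in L -> P x,
      forall x, P x -> exists2 y, y \in L & E x y &
      forall i j, (i < size L)%N -> (j < size L)%N ->
        E (nth (0,0,0) L i) (nth (0,0,0) L j) -> i = j].

(* weighted number of classes: sum of the weights over a system of class
   representatives (independent of the chosen system). *)
Definition wcount (E : form -> form -> Prop) (P : form -> Prop)
  (w : form -> rat) : rat :=
  epsilon (inhabits (0 : rat))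
    (fun r => exists L, rep_system E P L /\ r = \sum_(x <- L) w x).

Definition det_cl (f : form) : int := fb f ^+ 2 - fa f * fc f.
Definition divisor_cl (f : form) : int := gcdz (gcdz (fa f) (fb f)) (fc f).
Definition uneven_cl (f : form) : bool :=
  let d := divisor_cl f in
  ~~ ((2 %| (fa f %/ d))%Z && (2 %| (fc f %/ d))%Z).

Definition posdef_cl (f : form) : bool := (0 < fa f) && (det_cl f < 0).

Definition weight_cl (f : form) : rat :=
  if excluded_middle_informative (exists t : int, 1 <= t /\ equiv_cl f (t, 0, t)) then 1 / 2%:R
  else if excluded_middle_informative
          (exists t : int, 1 <= t /\ equiv_cl f (2 * t, t, 2 * t)) then 1 / 3%:R
  else 1.

Definition Fcl (n : nat) : rat :=
  wcount equiv_cl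
    (fun f => posdef_cl f /\ det_cl f = - (n%:Z) /\ uneven_cl f) weight_cl.
Definition F1cl (n : nat) : rat :=
  wcount equiv_cl
    (fun f => posdef_cl f /\ det_cl f = - (n%:Z) /\ ~~ uneven_cl f) weight_cl.

Definition Efun (n : nat) : rat := Fcl n - F1cl n.

Definition disc_g (f : form) : int := fb f ^+ 2 - 4 * fa f * fc f.
Definition primitive_g (f : form) : bool :=
  gcdz (gcdz (fa f) (fb f)) (fc f) == 1.

Definition hcl (D : int) : rat :=
  wcount equiv_g
    (fun f => [/\ 0 < fa f, disc_g f = D & primitive_g f]) (fun _ => 1).

Definition hw (D : int) : rat :=
  if D == -4 then 1 / 2%:R else if D == -3 then 1 / 3%:R else hcl D.

Definition sqfree (m : nat) : bool :=
  [forall d : 'I_m.+1, (1 < d)%N ==> ~~ (d * d %| m)%N].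

Definition fundamental (D : int) : bool :=
  (modz D 4 == 1) && sqfree `|D|%N
  || (4 %| D)%Z && ((modz (divz D 4) 4 == 2) || (modz (divz D 4) 4 == 3))
     && sqfree `|divz D 4|%N.

Definition conductor (N : nat) : nat :=
  \max_(t < N.+1 | (0 < t)%N && (t ^ 2 %| N)%N && fundamental (- (N %/ t ^ 2)%:Z)) t.

Definition Hurwitz (N : nat) : rat :=
  \sum_(t <- divisors (conductor N)) hw (- (N %/ t ^ 2)%:Z).

(* Main.v *)
Require Import Defs.
From mathcomp Require Import all_boot all_order all_algebra.
Import GRing.Theory Num.Theory.
Local Open Scope ring_scope.
From Stdlib Require Import ClassicalEpsilon.
From mathcomp Require Import zify ring.
Import Order.TTheory Defs.
Set Implicit Arguments. Unset Strict Implicit. Unset Printing Implicit Defensive.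

(* A form q of odd discriminant -n restricts to a classical form of determinant -n on each of the
   three sublattices of index 2, and this restriction is uneven exactly when q takes an odd value at
   the corresponding nonzero vector mod 2.  Conversely an uneven classical form of determinant -n,
   n = 3 (mod 4), comes from a unique such pair (q, sublattice), because its even values are all
   divisible by 4 and are taken on a sublattice of index 2.  If n = 3 (mod 8) all three sublattices
   occur, and the automorphs of q permute them trivially unless q is proportional to x^2 + xy + y^2,
   where they are permuted cyclically: this makes up for the weight 1/3 and F = 3 F_1.
   If n = 7 (mod 8) only one sublattice occurs and F = F_1.  In both cases F_1(n) = H(n) via
   q -> 2 q, while for n = 1, 2 (mod 4) there is no even form and F(n) = H(4n). *)

(** * Equivalence of forms *)

Lemma act_g_comp f p q r s p' q' r' s' :
  act_g (act_g f p q r s) p' q' r' s' =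
  act_g f (p * p' + q * r') (p * q' + q * s') (r * p' + s * r') (r * q' + s * s').
Proof. by case: f => [[a b] c]; congr (_, _, _); rewrite /fa /fb /fc /=; ring. Qed.

Lemma act_g1 f : act_g f 1 0 0 1 = f.
Proof.
by case: f => [[a b] c]; congr (_, _, _); rewrite /fa /fb /fc /=; ring.
Qed.

Lemma equiv_g_refl f : equiv_g f f.
Proof. by exists 1, 0, 0, 1; rewrite act_g1. Qed.

Lemma equiv_g_trans g f h : equiv_g f g -> equiv_g g h -> equiv_g f h.
Proof.
move=> [p [q [r [s [d <-]]]]] [p' [q' [r' [s' [d' <-]]]]].
do 4!eexists; split; last by rewrite act_g_comp.
transitivity ((p * s - q * r) * (p' * s' - q' * r')); first by ring.
by rewrite d d' mulr1.
Qed.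

Lemma equiv_g_sym f g : equiv_g f g -> equiv_g g f.
Proof.
move=> [p [q [r [s [d <-]]]]]; exists s, (- q), (- r), p; split; first by lia.
rewrite act_g_comp -[RHS]act_g1; congr act_g; lia.
Qed.

Lemma equiv_g_act f p q r s : p * s - q * r = 1 -> equiv_g f (act_g f p q r s).
Proof. by exists p, q, r, s. Qed.

Lemma disc_g_equiv f g : equiv_g f g -> disc_g g = disc_g f.
Proof.
case: f => [[a b] c] [p [q [r [s [d <-]]]]].
rewrite /disc_g /act_g /fa /fb /fc /=.
transitivity ((p * s - q * r) ^+ 2 * (b ^+ 2 - 4 * a * c)); first by ring.
by rewrite d expr1n mul1r.
Qed.

Lemma equiv_g_dvd (d : int) f g : equiv_g f g ->
  (d %| fa f)%Z -> (d %| fb f)%Z -> (d %| fc f)%Z ->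
  [/\ (d %| fa g)%Z, (d %| fb g)%Z & (d %| fc g)%Z].
Proof.
case: f => [[a b] c] [p [q [r [s [_ <-]]]]]; rewrite /fa /fb /fc /=.
move=> /dvdzP[a' ->] /dvdzP[b' ->] /dvdzP[c' ->].
split; apply/dvdzP.
- exists (a' * p ^+ 2 + b' * p * r + c' * r ^+ 2); rewrite /fa /fb /fc /=; ring.
- exists (2 * a' * p * q + b' * (p * s + q * r) + 2 * c' * r * s); rewrite /fa /fb /fc /=; ring.
- exists (a' * q ^+ 2 + b' * q * s + c' * s ^+ 2); rewrite /fa /fb /fc /=; ring.
Qed.

(** * The content of a form, and multiples of a form *)

Definition content (f : form) : int := gcdz (gcdz (fa f) (fb f)) (fc f).

Lemma dvdz_content d f :
  (d %| content f)%Z = [&& (d %| fa f)%Z, (d %| fb f)%Z & (d %| fc f)%Z].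
Proof. by rewrite /content !dvdz_gcd andbA. Qed.

Lemma content_ge0 f : 0 <= content f.
Proof. by []. Qed.

Lemma content_equiv f g : equiv_g f g -> content f = content g.
Proof.
move=> e; have h u v : equiv_g u v -> (content u %| content v)%Z.
  move=> e'; have := dvdzz (content u); rewrite [in X in X -> _]dvdz_content.
  case/and3P => da db dc; rewrite dvdz_content.
  by case: (equiv_g_dvd e' da db dc) => -> -> ->.
apply/eqP; rewrite -[content f]gez0_abs ?content_ge0 // -[content g]gez0_abs ?content_ge0 //.
rewrite eqz_nat eqn_dvd; apply/andP; split; [exact: (h _ _ e)|exact: (h _ _ (equiv_g_sym e))].
Qed.

Definition scale (t : int) (f : form) : form := (t * fa f, t * fb f, t * fc f).

Lemma act_g_scale t f p q r s :
  act_g (scale t f) p q r s = scale t (act_g f p q r s).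
Proof. by case: f => [[a b] c]; congr (_, _, _); rewrite /fa /fb /fc /=; ring. Qed.

Lemma disc_g_scale t f : disc_g (scale t f) = t ^+ 2 * disc_g f.
Proof. by rewrite /disc_g /scale /fa /fb /fc /=; ring. Qed.

Lemma scale_inj t : t != 0 -> injective (scale t).
Proof.
move=> t0 [[a b] c] [[a' b'] c'] [] /(mulfI t0) + /(mulfI t0) + /(mulfI t0).
by rewrite /fa /fb /fc /= => -> -> ->.
Qed.

Lemma equiv_g_scale t f g : t != 0 -> equiv_g (scale t f) (scale t g) <-> equiv_g f g.
Proof.
move=> t0; split=> -[p [q [r [s [d e]]]]]; exists p, q, r, s; split => //.
  by apply: (scale_inj t0); rewrite -act_g_scale.
by rewrite act_g_scale e.
Qed.

Lemma content_scale t f : 0 <= t -> content (scale t f) = t * content f.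
Proof.
move=> t0; rewrite /content /scale /fa /fb /fc /=.
by rewrite -mulz_gcdr gez0_abs // -mulz_gcdr gez0_abs.
Qed.

Lemma content_scaleE f : f != (0, 0, 0) ->
  exists2 g, f = scale (content f) g & content g = 1.
Proof.
case: f => [[a b] c] f0; have := dvdzz (content (a, b, c)).
rewrite [in X in X -> _]dvdz_content; move ed: (content _) => d.
rewrite /fa /fb /fc /= => /and3P[/dvdzP[a' ea] /dvdzP[b' eb] /dvdzP[c' ec]].
have e : (a, b, c) = scale d (a', b', c').
  by rewrite /scale /fa /fb /fc /= ea eb ec !(mulrC d).
exists (a', b', c') => //.
have d0 : d != 0.
  by apply: contraNneq f0 => d0; rewrite e /scale /fa /fb /fc /= d0 !mul0r.
apply: (mulfI d0); rewrite -content_scale; last by rewrite -ed content_ge0.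
by rewrite -e ed mulr1.
Qed.

(** The new leading coefficient is the value at the nonzero first column [(p, r)], and [4 a (a p^2 +
    b p r + c r^2) = (2 a p + b r)^2 - D r^2] with [D < 0]. *)
Lemma fa_equiv_gt0 f g : equiv_g f g -> 0 < fa f -> disc_g f < 0 -> 0 < fa g.
Proof.
case: f => [[a b] c] [p [q [r [s [d <-]]]]]; rewrite /disc_g /act_g /fa /fb /fc /= => a0 D0.
have [r0|r0] := eqVneq r 0.
  have p0 : p != 0 by apply/eqP => p0; move: d; rewrite p0 r0; lia.
  have : 0 < p ^+ 2 by rewrite exprn_even_gt0.
  rewrite r0; nia.
have r2 : 0 < r ^+ 2 by rewrite exprn_even_gt0.
have : 0 < 4 * a * (a * p ^+ 2 + b * p * r + c * r ^+ 2).
  rewrite (_ : _ * _ = (2 * a * p + b * r) ^+ 2 + (4 * a * c - b ^+ 2) * r ^+ 2); last ring.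
  have := sqr_ge0 (2 * a * p + b * r); nia.
by rewrite pmulr_rgt0 //; lia.
Qed.

(** * Weights *)

(** One weight serves both sides of the theorem. The exceptional forms are the multiples of
    [x^2 + y^2] and [x^2 + x y + y^2], whether they come from classical forms or from [hw]. *)
Definition wt (f : form) : rat :=
  if excluded_middle_informative (exists t : int, 1 <= t /\ equiv_g f (t, 0, t))
  then 1 / 2%:R
  else if excluded_middle_informative (exists t : int, 1 <= t /\ equiv_g f (t, t, t))
  then 1 / 3%:R else 1.

Lemma if_em_iff (T : Type) (P Q : Prop) (x y : T) : (P <-> Q) ->
  (if excluded_middle_informative P then x else y) =
  (if excluded_middle_informative Q then x else y).
Proof.
move=> [PQ QP].
case: excluded_middle_informative => [p|np]; case: excluded_middle_informative => [q|nq] //.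
  by case: nq; apply: PQ.
by case: np; apply: QP.
Qed.

Lemma wt_iff f g :
  ((exists t : int, 1 <= t /\ equiv_g f (t, 0, t)) <->
   (exists t : int, 1 <= t /\ equiv_g g (t, 0, t))) ->
  ((exists t : int, 1 <= t /\ equiv_g f (t, t, t)) <->
   (exists t : int, 1 <= t /\ equiv_g g (t, t, t))) -> wt f = wt g.
Proof. by move=> h1 h2; rewrite /wt (if_em_iff _ _ h1) (if_em_iff _ _ h2). Qed.

Lemma wt_equiv f g : equiv_g f g -> wt f = wt g.
Proof.
move=> e; have e' := equiv_g_sym e.
by apply: wt_iff; split=> -[t [t1 h]]; exists t; split => //; apply: equiv_g_trans h.
Qed.

(** If [k f] is equivalent to [t (u, v, w)] with [(u, v, w)] of content 1, then comparing contents
    gives [t = k * content f], and [k] can be cancelled. *)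
Lemma wt_scale k f : 1 <= k -> wt (scale k f) = wt f.
Proof.
move=> k1; have k0 : k != 0 by lia.
have key (u v w : int) :
  (exists t : int, 1 <= t /\ equiv_g (scale k f) (t * u, t * v, t * w)) ->
  content (u, v, w) = 1 ->
  exists t : int, 1 <= t /\ equiv_g f (t * u, t * v, t * w).
  move=> [t [t1 e]] c1; have:= content_equiv e.
  rewrite (_ : (_, _, _) = scale t (u, v, w)) // !content_scale ?c1; try lia.
  rewrite mulr1 => et; exists (content f); split; first by nia.
  by apply/(equiv_g_scale _ _ k0); move: e; rewrite -et /scale /fa /fb /fc /= !mulrA.
have h t : (t * 1, t * 0, t * 1) = (t, 0, t) by rewrite !mulr1 mulr0.
have h' t : (t * 1, t * 1, t * 1) = (t, t, t) by rewrite !mulr1.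
apply: wt_iff; split=> -[t [t1 e]].
- have [] := key 1 0 1 => //; first by exists t; rewrite h.
  by move=> t'; rewrite h; exists t'.
- exists (k * t); split; first by nia.
  by move/(equiv_g_scale _ _ k0): e; rewrite /scale /fa /fb /fc /= mulr0.
- have [] := key 1 1 1 => //; first by exists t; rewrite h'.
  by move=> t'; rewrite h'; exists t'.
- exists (k * t); split; first by nia.
  by move/(equiv_g_scale _ _ k0): e; rewrite /scale /fa /fb /fc /=.
Qed.

(** The same quadratic form, written with its full middle coefficient. It commutes with the two
    actions, so that classical forms can be studied through [equiv_g]. *)
Definition dbl (f : form) : form := (fa f, 2 * fb f, fc f).

Lemma dbl_inj : injective dbl.
Proof.
move=> [[a b] c] [[a' b'] c'] []; rewrite /fa /fb /fc /= => -> e ->.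
by congr (_, _, _); lia.
Qed.

Lemma act_g_dbl f p q r s : act_g (dbl f) p q r s = dbl (act_cl f p q r s).
Proof. by case: f => [[a b] c]; congr (_, _, _); rewrite /fa /fb /fc /=; ring. Qed.

Lemma equiv_dbl f g : equiv_g (dbl f) (dbl g) <-> equiv_cl f g.
Proof.
split=> -[p [q [r [s [d e]]]]]; exists p, q, r, s; split => //.
  by apply: dbl_inj; rewrite -act_g_dbl.
by rewrite act_g_dbl e.
Qed.

Lemma disc_g_dbl f : disc_g (dbl f) = 4 * det_cl f.
Proof. by rewrite /disc_g /det_cl /dbl /fa /fb /fc /=; ring. Qed.

Lemma equiv_cl_refl f : equiv_cl f f.
Proof. by apply/equiv_dbl/equiv_g_refl. Qed.

Lemma equiv_cl_sym f g : equiv_cl f g -> equiv_cl g f.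
Proof. by move=> /equiv_dbl/equiv_g_sym/equiv_dbl. Qed.

Lemma equiv_cl_trans g f h : equiv_cl f g -> equiv_cl g h -> equiv_cl f h.
Proof. by move=> /equiv_dbl fg /equiv_dbl gh; apply/equiv_dbl/(equiv_g_trans fg). Qed.

(** If [dbl f] is equivalent to [(t, t, t)], then [-3 t^2 = 4 * det_cl f]. Hence [t] is even, and
    [t = 2 u] gives the classical triple [(2 u, u, 2 u)]. *)
Lemma weight_clE f : weight_cl f = wt (dbl f).
Proof.
rewrite /weight_cl /wt.
have h1 : (exists t, 1 <= t /\ equiv_cl f (t, 0, t)) <->
          (exists t, 1 <= t /\ equiv_g (dbl f) (t, 0, t)).
  by split=> -[t [t1 e]]; exists t; split=> //; apply/(equiv_dbl _ (t, 0, t)).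
have h2 : (exists t, 1 <= t /\ equiv_cl f (2 * t, t, 2 * t)) <->
          (exists t, 1 <= t /\ equiv_g (dbl f) (t, t, t)).
  split=> -[t [t1 e]].
    by exists (2 * t); split; [lia|apply/(equiv_dbl _ (2 * t, t, 2 * t))].
  have := disc_g_equiv e; rewrite disc_g_dbl /disc_g /fa /fb /fc /= => D.
  have [u et] : exists u, t = 2 * u by exists (t %/ 2)%Z; nia.
  move: e; rewrite et => e.
  by exists u; split; [lia|apply/(equiv_dbl _ (2 * u, u, 2 * u))].
by rewrite (if_em_iff _ _ h1) (if_em_iff _ _ h2).
Qed.

Lemma weight_cl_equiv f g : equiv_cl f g -> weight_cl f = weight_cl g.
Proof. by move=> /equiv_dbl e; rewrite !weight_clE; apply: wt_equiv. Qed.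

(** * Systems of representatives *)

Record equivalence (E : form -> form -> Prop) : Prop := Equivalence {
  eqv_refl : forall x, E x x;
  eqv_sym : forall x y, E x y -> E y x;
  eqv_trans : forall y x z, E x y -> E y z -> E x z }.

Lemma equiv_gE : equivalence equiv_g.
Proof.
split; [exact: equiv_g_refl|exact: equiv_g_sym|exact: equiv_g_trans].
Qed.

Lemma equiv_clE : equivalence equiv_cl.
Proof.
split; [exact: equiv_cl_refl|exact: equiv_cl_sym|exact: equiv_cl_trans].
Qed.

Section RepSystem.
Variables (E : form -> form -> Prop) (P : form -> Prop) (w : form -> rat).
Hypothesis eqE : equivalence E.
Hypothesis wE : forall x y, E x y -> w x = w y.

Lemma rep_systemE L : rep_system E P L ->
  [/\ uniq L, {in L, forall x, P x}, forall x, P x -> exists2 y, y \in L & E x y &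
      {in L &, forall x y, E x y -> x = y}].
Proof.
move=> [LP PL inj]; split => //.
  by apply/(uniqP (0, 0, 0)) => i j si sj e; apply: inj => //; rewrite e; apply: eqv_refl.
move=> x y /(nthP (0, 0, 0))[i si <-] /(nthP (0, 0, 0))[j sj <-] e.
by rewrite (inj i j).
Qed.

(** The index type is arbitrary because classes are later indexed by pairs: content and primitive
    form, or form and sublattice. *)
Lemma rep_system_map (I : eqType) (r : seq I) (phi : I -> form) :
  uniq r -> {in r, forall i, P (phi i)} ->
  (forall x, P x -> exists2 i, i \in r & E x (phi i)) ->
  {in r &, forall i j, E (phi i) (phi j) -> i = j} ->
  rep_system E P (map phi r).
Proof.
move=> ur rP Pr inj; split.
- by move=> x /mapP[i ir ->]; apply: rP.
- by move=> x /Pr[i ir e]; exists (phi i) => //; apply: map_f.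
move=> i j; rewrite size_map => si sj.
case: r ur rP Pr inj si sj => // i0 r ur rP Pr inj si sj.
rewrite !(nth_map i0) // => /inj e.
by apply/eqP; rewrite -(nth_uniq i0 si sj ur); apply/eqP/e; apply: mem_nth.
Qed.

(** Induction on [L]: the head is matched with its partner in [L'], and both are removed. *)
Lemma sum_transversal L L' :
  uniq L -> uniq L' ->
  {in L &, forall x y, E x y -> x = y} -> {in L' &, forall x y, E x y -> x = y} ->
  (forall x, x \in L -> exists2 y, y \in L' & E x y) ->
  (forall y, y \in L' -> exists2 x, x \in L & E x y) ->
  \sum_(x <- L) w x = \sum_(x <- L') w x.
Proof.
elim: L L' => [|x L IH] L' uL uL' injL injL' LL' L'L.
  case: L' uL' injL' LL' L'L => [|y L'] _ _ _ => [|/(_ y)]; first by rewrite !big_nil.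
  by rewrite inE eqxx => -[].
have [y yL' xy] := LL' x (mem_head _ _).
have [xL {}uL] := andP uL.
rewrite big_cons (perm_big _ (perm_to_rem yL')) big_cons (wE xy); congr (_ + _).
apply: IH => //.
- exact: rem_uniq.
- by move=> u v uL1 vL1; apply: injL; rewrite inE ?uL1 ?vL1 orbT.
- by move=> u v /mem_rem uL1 /mem_rem vL1; apply: injL'.
- move=> u uL1; have [|v vL' uv] := LL' u; first by rewrite inE uL1 orbT.
  exists v => //; rewrite mem_rem_uniq // inE vL' andbT; apply/eqP => vy.
  suff : u = x by move=> ux; rewrite -ux uL1 in xL.
  apply: injL; rewrite ?inE ?uL1 ?eqxx ?orbT //.
  by apply: (eqv_trans eqE uv); rewrite vy; apply: (eqv_sym eqE).
- move=> v; rewrite mem_rem_uniq // inE => /andP[vy vL'].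
  have [u + uv] := L'L v vL'; rewrite inE => /predU1P[ux|]; last by exists u.
  case/eqP: vy; apply: injL' => //; apply: (eqv_sym eqE).
  by apply: (eqv_trans eqE) (eqv_sym eqE xy) _; rewrite -ux.
Qed.

(** The [epsilon] in [wcount] selects the sum over some unknown system; any two systems give the
    same sum. *)
Lemma wcountE L : rep_system E P L -> wcount E P w = \sum_(x <- L) w x.
Proof.
move=> rL; rewrite /wcount.
have [] := @epsilon_spec _ (inhabits (0 : rat))
  (fun r => exists L, rep_system E P L /\ r = \sum_(x <- L) w x) _.
  by exists (\sum_(x <- L) w x), L.
move=> L' [rL' ->].
have [uL LP PL injL] := rep_systemE rL; have [uL' LP' PL' injL'] := rep_systemE rL'.
apply: sum_transversal => // [x /LP' /PL //|y /LP /PL' [x xL' yx]].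
by exists x => //; apply: (eqv_sym eqE).
Qed.

(** The list [S] is thinned: an element is kept only if it is equivalent to none of those kept
    already. *)
Lemma exists_rep_system (S : seq form) :
  {in S, forall x, P x} -> (forall x, P x -> exists2 y, y \in S & E x y) ->
  exists L : seq form, {subset L <= S} /\ rep_system E P L.
Proof.
move=> SP PS.
have [L [LS uL injL SL]] : exists L : seq form, [/\ {subset L <= S}, uniq L,
    {in L &, forall x y, E x y -> x = y} & forall x, x \in S -> exists2 y, y \in L & E x y].
  elim: S {SP PS} => [|x S [L [LS uL injL SL]]]; first by exists [::].
  have [[y yL xy]|nx] := excluded_middle_informative (exists2 y, y \in L & E x y).
    exists L; split => //; first by move=> u /LS uS; rewrite inE uS orbT.
    by move=> u; rewrite inE => /predU1P[->|/SL//]; exists y.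
  exists (x :: L); split.
  - by move=> u; rewrite !inE => /predU1P[->|/LS ->]; rewrite ?eqxx ?orbT.
  - rewrite /= uL andbT; apply/negP => xL; apply: nx; exists x => //; exact: eqv_refl.
  - move=> u v; rewrite !inE => /predU1P[->|uL1] /predU1P[->|vL1] e //.
    + by case: nx; exists v.
    + by case: nx; exists u => //; apply: (eqv_sym eqE).
    + exact: injL.
  - move=> u; rewrite inE => /predU1P[->|/SL[y yL uy]].
      by exists x; rewrite ?mem_head //; apply: eqv_refl.
    by exists y => //; rewrite inE yL orbT.
exists L; split=> //; rewrite -(map_id L); apply: rep_system_map => //.
  by move=> x /LS /SP.
move=> x /PS[y yS xy]; have [z zL yz] := SL y yS; exists z => //.
exact: eqv_trans xy yz.
Qed.

End RepSystem.

(** * Reduction *)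

Definition gform (D : int) (f : form) : Prop := 0 < fa f /\ disc_g f = D.

(** Gauss's inequalities, with no sign condition on [b] when [a = c]. A class may thus contain two
    reduced forms; repetitions are removed by [exists_rep_system]. *)
Definition reduced (f : form) : bool := [&& - fa f < fb f, fb f <= fa f & fa f <= fc f].

Lemma gform_equiv D f g : D < 0 -> gform D f -> equiv_g f g -> gform D g.
Proof.
move=> D0 [a0 Df] e; split; last by rewrite (disc_g_equiv e).
by apply: fa_equiv_gt0 e a0 _; rewrite Df.
Qed.

Lemma reduction D f : D < 0 -> gform D f -> exists2 g, reduced g & equiv_g f g.
Proof.
move=> D0; have [m] := ubnP `|fa f|%N; elim: m f => // m IH [[a b] c] am fD.
have [a0 Df] := fD; rewrite /fa /fb /fc /= in am a0 Df.
(* With this [k], [b + 2 a k] equals [a] minus the residue of [a - b] modulo [2 a], so it lies in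
   the interval from [-a] (excluded) to [a]. *)
pose k := ((a - b) %/ (2 * a))%Z.
have lt_mod := ltz_pmod (a - b) (_ : 0 < 2 * a).
have ge_mod := modz_ge0 (a - b) (_ : 2 * a != 0).
have ediv := divz_eq (a - b) (2 * a).
pose g := act_g (a, b, c) 1 k 0 1.
have eg : equiv_g (a, b, c) g by apply: equiv_g_act; lia.
have gD := gform_equiv D0 fD eg.
have ga : fa g = a by rewrite /g /act_g /fa /=; ring.
have gb : fb g = b + 2 * a * k by rewrite /g /act_g /fa /fb /=; ring.
have [le_ac|lt_ca] := leP (fa g) (fc g).
  exists g => //; rewrite /reduced le_ac ga gb andbT.
  move: lt_mod ge_mod; rewrite -/k in ediv *; lia.
(* If [c < a], exchanging the outer coefficients lowers the leading one, on which the descent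
   runs. *)
have [] := IH (act_g g 0 (-1) 1 0).
- have -> : fa (act_g g 0 (-1) 1 0) = fc g by rewrite /act_g {1}/fa /=; ring.
  have c0 : 0 < fc g.
    case: gD => a1; have := sqr_ge0 (fb g); rewrite /disc_g -(pmulr_rgt0 _ a1); lia.
  by rewrite ga in lt_ca; lia.
- by apply: (gform_equiv D0 gD); apply: equiv_g_act.
move=> h rh eh; exists h => //; apply: equiv_g_trans eg (equiv_g_trans _ eh).
exact: equiv_g_act.
Qed.

Definition int_range (N : nat) : seq int := [seq k%:Z - N%:Z | k <- iota 0 (2 * N).+1].

Lemma mem_int_range N (x : int) : `|x| <= N%:Z -> x \in int_range N.
Proof.
move=> xN; apply/mapP; exists `|(x + N%:Z)%R|%N; last by lia.
by rewrite mem_iota; lia.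
Qed.

Definition reduced_forms (N : nat) : seq form :=
  [seq (ab, c) | ab <- [seq (a, b) | a <- int_range N, b <- int_range N], c <- int_range N].

(** From [|b| <= a <= c] follows [N = 4 a c - b^2 >= 3 a c], which bounds all three coefficients by
    [N]. *)
Lemma mem_reduced_forms N f : gform (- N%:Z) f -> reduced f -> f \in reduced_forms N.
Proof.
case: f => [[a b] c] [] /=; rewrite /reduced /disc_g /fa /fb /fc /= => a0 D /and3P[h1 h2 h3].
have b2 : b ^+ 2 <= a ^+ 2 by nia.
have aN : a <= N%:Z by nia.
have cN : c <= N%:Z by nia.
have [aI bI cI] : [/\ a \in int_range N, b \in int_range N & c \in int_range N].
  by split; apply: mem_int_range; lia.
apply/allpairsP; exists ((a, b), c); split => //.
by apply/allpairsP; exists (a, b).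
Qed.

Lemma exists_reduced_reps (Q : form -> Prop) D : D < 0 ->
  (forall x, Q x -> gform D x) -> (forall x y, Q x -> equiv_g x y -> Q y) ->
  exists2 L, rep_system equiv_g Q L & {in L, forall x, reduced x}.
Proof.
move=> D0 QD QE.
pose S := [seq x <- reduced_forms `|D|%N |
  (if excluded_middle_informative (Q x) then true else false) && reduced x].
have [|| L [LS rL]] := @exists_rep_system _ Q equiv_gE S.
- by move=> x; rewrite mem_filter => /andP[/andP[+ _] _]; case: excluded_middle_informative.
- move=> x Qx; have [y ry xy] := reduction D0 (QD _ Qx); exists y => //.
  have Qy := QE _ _ Qx xy.
  rewrite mem_filter ry andbT mem_reduced_forms //; last first.
    by have [y0 yD] := QD _ Qy; split=> //; rewrite yD; lia.
  by case: excluded_middle_informative.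
by exists L => // x /LS; rewrite mem_filter => /andP[/andP[]].
Qed.

(** * Hurwitz class numbers *)

Lemma sqfree_le1 m d : (0 < m)%N -> sqfree m -> (d * d %| m)%N -> (d <= 1)%N.
Proof.
move=> m0 /forallP sq dm; rewrite leqNgt; apply/negP => d1.
have dm1 : (d < m.+1)%N.
  by rewrite ltnS (leq_trans _ (dvdn_leq m0 dm)) // leq_pmulr // ltnW.
by have := sq (Ordinal dm1); rewrite /= d1 dm.
Qed.

Lemma sqfreePn m : ~~ sqfree m -> exists2 d, (1 < d)%N & (d * d %| m)%N.
Proof.
by rewrite negb_forall => /existsP[d]; rewrite negb_imply negbK => /andP[]; exists d.
Qed.

(** The condition that [-N] is 0 or 1 modulo 4, that is, a possible discriminant. *)
Definition disc_abs (N : nat) : bool := (N %% 4 == 0)%N || (N %% 4 == 3)%N.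

Lemma fundamentalN M : fundamental (- M%:Z) =
  (M %% 4 == 3)%N && sqfree M ||
  (4 %| M)%N && ((M %/ 4 %% 4 == 1)%N || (M %/ 4 %% 4 == 2)%N) && sqfree (M %/ 4).
Proof.
rewrite /fundamental abszN absz_nat.
have -> : (modz (- M%:Z) 4 == 1) = (M %% 4 == 3)%N by lia.
have [M4|nM4] := boolP (4 %| M)%N; last first.
  by have -> : (4 %| - M%:Z)%Z = false by lia.
have -> : (4 %| - M%:Z)%Z by lia.
have -> : divz (- M%:Z) 4 = - (M %/ 4)%:Z by lia.
rewrite abszN absz_nat /=; congr (_ || _ && _); lia.
Qed.

Lemma sqr_mod4 u : (u ^ 2 %% 4 = odd u)%N.
Proof.
rewrite -[in LHS](odd_double_half u) -muln2 expnS expn1.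
by case: (odd u); lia.
Qed.

Lemma disc_abs_sqr u M : disc_abs M -> disc_abs (u ^ 2 * M).
Proof.
by rewrite /disc_abs -modnMml sqr_mod4; case: (odd u); rewrite ?mul1n.
Qed.

Lemma disc_abs_fundamental M : fundamental (- M%:Z) -> disc_abs M.
Proof. by rewrite fundamentalN /disc_abs; lia. Qed.

(** Descent: from a discriminant that is not fundamental, a square factor [d^2] with [d > 1] can be
    removed so that a discriminant remains. *)
Lemma exists_fundamental N : (0 < N)%N -> disc_abs N ->
  exists t, [/\ (0 < t)%N, (t ^ 2 %| N)%N & fundamental (- (N %/ t ^ 2)%:Z)].
Proof.
have [m] := ubnP N; elim: m N => // m IH N Nm N0 NA.
have [fN|nfN] := boolP (fundamental (- N%:Z)).
  by exists 1%N; rewrite exp1n dvd1n divn1.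
suff [d d1 [k Nk kA]] : exists2 d, (1 < d)%N & exists2 k, N = (d ^ 2 * k)%N & disc_abs k.
  have [||| t [t0 /dvdnP[j kj] ft]] := IH k; rewrite ?kA //; try nia.
  move: ft; rewrite kj mulnK ?expn_gt0 ?t0 // => fj; exists (t * d)%N.
  have -> : (N = j * (t * d) ^ 2)%N by rewrite Nk kj expnMn; ring.
  have td0 : (0 < t * d)%N by rewrite muln_gt0 t0 ltnW.
  by rewrite mulnK ?expn_gt0 ?td0 // dvdn_mull.
move: nfN; rewrite fundamentalN negb_or; case/orP: NA => N4; last first.
  rewrite N4 /= => /andP[/sqfreePn[d d1 /dvdnP[k Nk]] _]; exists d => //; exists k.
    by rewrite Nk mulnC mulnn.
  move: N4; rewrite Nk mulnC mulnn -modnMml sqr_mod4 /disc_abs.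
  by case: (odd d); rewrite ?mul0n ?mul1n // => /eqP->.
have {N4} /dvdnP[M NM] : (4 %| N)%N by exact: N4.
rewrite NM mulnK // dvdn_mull //= => /andP[_ /nandP[M4|/sqfreePn[d d1 /dvdnP[k Mk]]]].
  by exists 2%N => //; exists M; [rewrite mulnC|rewrite /disc_abs; lia].
have [M4|nM4] := boolP (disc_abs M); first by exists 2%N => //; exists M; rewrite // mulnC.
(* Here [M = N / 4] is not a discriminant but has a square factor [d^2]; the factor 4 is left in the
   quotient. *)
exists d => //; exists (4 * k)%N; first by rewrite Mk -mulnn; ring.
by rewrite /disc_abs -modnMml modnn.
Qed.

(** The maximum that defines [conductor] ranges over a nonempty set, hence is attained. *)
Lemma conductorP N : (0 < N)%N -> disc_abs N ->
  [/\ (0 < conductor N)%N, (conductor N ^ 2 %| N)%N &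
      fundamental (- (N %/ conductor N ^ 2)%:Z)].
Proof.
move=> N0 NA; have [t [t0 tN ft]] := exists_fundamental N0 NA.
have tN1 : (t < N.+1)%N.
  by rewrite ltnS (leq_trans _ (dvdn_leq N0 tN)) // -mulnn leq_pmulr.
pose A := [pred t : 'I_N.+1 | (0 < t)%N && (t ^ 2 %| N)%N && fundamental (- (N %/ t ^ 2)%:Z)].
have [|i iA] := @eq_bigmax_cond _ A (fun t : 'I_N.+1 => t : nat).
  by apply/card_gt0P; exists (Ordinal tN1); rewrite inE /= t0 tN ft.
rewrite (_ : \max_(i in A) i = conductor N)%N; last by apply: eq_bigl.
by move=> ->; move: iA; rewrite inE => /andP[/andP[]].
Qed.

(** If [M] is squarefree this is immediate. If [M = 4 m], an odd [s] has its square dividing the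
    squarefree [m]; an even [s] gives [m = (s / 2)^2 * k], so [m = k], although [m] is 1 or 2 modulo
    4. *)
Lemma fundamental_sqr M s k : (0 < M)%N -> fundamental (- M%:Z) ->
  M = (s ^ 2 * k)%N -> disc_abs k -> s = 1%N.
Proof.
move=> M0 fM Ms kA; have s0 : (0 < s)%N by case: s Ms M0 => // ->.
suff : (s <= 1)%N by lia.
move: fM; rewrite fundamentalN => /orP[/andP[_ sq]|/andP[/andP[M4 mM] sq]].
  by apply: sqfree_le1 M0 sq _; rewrite Ms mulnn dvdn_mulr.
have [m Mm] := dvdnP M4; rewrite Mm mulnK // in mM sq.
have m0 : (0 < m)%N by lia.
have [os|es] := boolP (odd s).
  apply: sqfree_le1 m0 sq _; rewrite mulnn -(@Gauss_dvdl _ _ 4).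
    by rewrite -Mm Ms dvdn_mulr.
  by rewrite coprime_pexpl // (@coprime_pexpr 2 _ 2) // coprimen2.
have [u su] : exists u, s = (2 * u)%N by exists s./2; lia.
have mk : m = (u * u * k)%N.
  by move: Ms; rewrite Mm su expnMn -mulnn; lia.
have u1 : (u <= 1)%N by apply: sqfree_le1 m0 sq _; rewrite mk dvdn_mulr.
have u1' : u = 1%N by lia.
by move: mM kA; rewrite mk u1' /disc_abs; lia.
Qed.

(** This turns divisors of the conductor into possible contents of forms of discriminant [-N]: those
    [t] for which [-N / t^2] is again a discriminant. *)
Lemma mem_divisors_conductor N t : (0 < N)%N -> disc_abs N ->
  (t \in divisors (conductor N)) = (t ^ 2 %| N)%N && disc_abs (N %/ t ^ 2).
Proof.
move=> N0 NA; have [f0 fN ff] := conductorP N0 NA.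
move: (conductor N) f0 fN ff => f f0 /dvdnP[M NM]; rewrite {1}NM mulnK ?expn_gt0 ?f0 // => fM.
have M0 : (0 < M)%N by case: M NM {fM} N0 => // ->.
rewrite -dvdn_divisors //; apply/idP/andP => [/dvdnP[u fu]|[/dvdnP[K NK] KA]].
  have t0 : (0 < t)%N by case: t fu f0 => // ->; rewrite muln0.
  have e : N = (u ^ 2 * M * t ^ 2)%N by rewrite NM fu expnMn; ring.
  rewrite e dvdn_mull // mulnK ?expn_gt0 ?t0 //; split=> //.
  by apply: disc_abs_sqr; apply: disc_abs_fundamental.
have t0 : (0 < t)%N by case: t NK N0 {KA} => // ->; rewrite muln0.
move: KA; rewrite NK mulnK ?expn_gt0 ?t0 // => KA.
(* Dividing [f] and [t] by their gcd leaves [M f'^2 = K t'^2] with [f'] and [t'] coprime, so that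
   [t'^2] divides the fundamental [M]. It remains to see that [t' = 1]. *)
pose g := gcdn f t; have g0 : (0 < g)%N by rewrite gcdn_gt0 f0.
have [f' ef] := dvdnP (dvdn_gcdl f t); have [t' et] := dvdnP (dvdn_gcdr f t).
rewrite -/g in ef et.
have cop : coprime f' t'.
  by rewrite /coprime -(eqn_pmul2r g0) muln_gcdl -ef -et mul1n.
have e : (M * f' ^ 2 = K * t' ^ 2)%N.
  apply/eqP; rewrite -(@eqn_pmul2r (g ^ 2)) ?expn_gt0 ?g0 //.
  by move: NM; rewrite NK ef et !expnMn !mulnA => ->.
have /dvdnP[k Mk] : (t' ^ 2 %| M)%N.
  rewrite -(@Gauss_dvdl _ _ (f' ^ 2)); first by rewrite e; apply: dvdn_mull.
  by rewrite coprime_pexpl // coprime_pexpr // coprime_sym.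
suff t1 : t' = 1%N by rewrite et t1 mul1n /g dvdn_gcdl.
have t'0 : (0 < t' ^ 2)%N by rewrite expn_gt0; case: t' et t0 {cop e Mk} => // ->.
have Kk : K = (f' ^ 2 * k)%N.
  by apply/eqP; rewrite -(eqn_pmul2r t'0) -e Mk; apply/eqP; ring.
have [kA|nkA] := boolP (disc_abs k).
  by apply: fundamental_sqr M0 fM _ kA; rewrite Mk mulnC.
(* Odd squares are 1 modulo 4. Since [K = f'^2 k] is a discriminant and [k] is not, [f'] is even;
   then [t'] is odd and [M = t'^2 k] is congruent to [k], a contradiction. *)
have of' : ~~ odd f'.
  apply: contra nkA => of'; move: KA.
  by rewrite Kk /disc_abs -modnMml sqr_mod4 of' mul1n.
have ot' : odd t'.
  by move: cop; rewrite -[f']odd_double_half (negPf of') add0n -mul2n coprimeMl coprime2n => /andP[].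
case/negP: nkA; have := disc_abs_fundamental fM.
by rewrite Mk mulnC /disc_abs -modnMml sqr_mod4 ot' mul1n.
Qed.

(** * Primitive forms, and classification by content *)

Definition prim (D : int) (f : form) : Prop := [/\ 0 < fa f, disc_g f = D & primitive_g f].

Lemma primE D f : prim D f <-> gform D f /\ content f = 1.
Proof.
by split=> [[a0 fD /eqP f1]|[[a0 fD] f1]]; split => //; apply/eqP.
Qed.

Lemma prim_equiv D f g : D < 0 -> prim D f -> equiv_g f g -> prim D g.
Proof.
move=> D0 /primE[fD f1] e; apply/primE; split; first exact: gform_equiv e.
by rewrite -(content_equiv e).
Qed.

Lemma equiv_disc4 f : gform (-4) f -> equiv_g f (1, 0, 1).
Proof.
move=> fD; have [g rg e] := reduction (isT : -4 < 0 :> int) fD.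
suff -> : (1, 0, 1) = g by [].
have [] := gform_equiv (isT : -4 < 0 :> int) fD e; case: g rg {e} => [[a b] c].
rewrite /reduced /disc_g /fa /fb /fc /= => /and3P[h1 h2 h3] a0 D.
have ea : a = 1 by nia.
have eb : b = 0.
  have [//|b1] : b = 0 \/ b = 1 by lia.
  by move: D; rewrite ea b1; lia.
have ec : c = 1 by move: D; rewrite ea eb; lia.
by rewrite ea eb ec.
Qed.

(** An equality rather than an equivalence, so that multiples of [x^2 + x y + y^2] can be recognised
    among reduced forms by their coefficients. *)
Lemma reduced_disc3 f : gform (-3) f -> reduced f -> f = (1, 1, 1).
Proof.
case: f => [[a b] c] []; rewrite /reduced /disc_g /fa /fb /fc /= => a0 D /and3P[h1 h2 h3].
have ea : a = 1 by nia.
have eb : b = 1.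
  have [b0|//] : b = 0 \/ b = 1 by lia.
  by move: D; rewrite ea b0; lia.
have ec : c = 1 by move: D; rewrite ea eb; lia.
by rewrite ea eb ec.
Qed.

Lemma equiv_disc3 f : gform (-3) f -> equiv_g f (1, 1, 1).
Proof.
move=> fD; have D0 : -3 < 0 :> int by [].
have [g rg e] := reduction D0 fD.
by rewrite -(reduced_disc3 (gform_equiv D0 fD e) rg).
Qed.

Lemma wt_half f t : 1 <= t -> equiv_g f (t, 0, t) -> wt f = 1 / 2%:R.
Proof.
by move=> t1 e; rewrite /wt; case: excluded_middle_informative => // -[]; exists t.
Qed.

Lemma disc_t0t f (t : int) : equiv_g f (t, 0, t) -> disc_g f = - (4 * t ^+ 2).
Proof. by move=> e; rewrite -(disc_g_equiv e) /disc_g /fa /fb /fc /=; ring. Qed.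

Lemma disc_ttt f (t : int) : equiv_g f (t, t, t) -> disc_g f = - (3 * t ^+ 2).
Proof. by move=> e; rewrite -(disc_g_equiv e) /disc_g /fa /fb /fc /=; ring. Qed.

(** The test for [(u, 0, u)] comes first and must fail: equal contents would give [t = u], and the
    discriminants [-3 t^2] and [-4 t^2] differ. *)
Lemma wt_third f t : 1 <= t -> equiv_g f (t, t, t) -> wt f = 1 / 3%:R.
Proof.
move=> t1 e; rewrite /wt; case: excluded_middle_informative => [[u [u1 e']]|nh].
  have ce := content_equiv e'.
  rewrite (content_equiv e) (_ : (t, t, t) = scale t (1, 1, 1)) in ce; last first.
    by rewrite /scale /fa /fb /fc /= !mulr1.
  rewrite (_ : (u, 0, u) = scale u (1, 0, 1)) in ce; last first.
    by rewrite /scale /fa /fb /fc /= !mulr1 mulr0.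
  rewrite !content_scale in ce; try lia.
  have tu : t = u by move: ce; rewrite !mulr1.
  have := disc_ttt e; rewrite (disc_t0t e') tu; nia.
by case: excluded_middle_informative => // -[]; exists t.
Qed.

Lemma wt_one f :
  (forall t, 1 <= t -> ~ equiv_g f (t, 0, t)) ->
  (forall t, 1 <= t -> ~ equiv_g f (t, t, t)) -> wt f = 1.
Proof.
move=> h1 h2; rewrite /wt; case: excluded_middle_informative => [[t [t1 e]]|nh].
  by case: (h1 t t1).
by case: excluded_middle_informative => // -[t [t1 e]]; case: (h2 t t1).
Qed.

(** Discriminants -4 and -3 have one class, of weight 1/2 and 1/3. For any other [D], content 1
    would force [t = 1] in an exceptional form and hence [D = -4] or [D = -3], so all weights are
    1. *)
Lemma hwE D L : D < 0 -> rep_system equiv_g (prim D) L -> hw D = \sum_(x <- L) wt x.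
Proof.
move=> D0 rL; have uL := wcountE equiv_gE wt_equiv rL.
have single x : prim D x -> (forall f, gform D f -> equiv_g f x) -> \sum_(x <- L) wt x = wt x.
  move=> xD Dx; rewrite -uL (wcountE equiv_gE wt_equiv (L := [:: x])) ?big_seq1 //.
  rewrite -(map_id [:: x]); apply: rep_system_map => //.
  - by move=> i; rewrite inE => /eqP->.
  - by move=> f /primE[/Dx e _]; exists x; rewrite ?mem_head.
  - by move=> i j; rewrite !inE => /eqP-> /eqP->.
rewrite /hw; have [D4|D4] := eqVneq D (-4).
  rewrite D4 in single *; rewrite (single (1, 0, 1)) //; last exact: equiv_disc4.
  by rewrite (wt_half (t := 1)) //; apply: equiv_g_refl.
have [D3|D3] := eqVneq D (-3).
  rewrite D3 in single *; rewrite (single (1, 1, 1)) //; last exact: equiv_disc3.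
  by rewrite (wt_third (t := 1)) //; apply: equiv_g_refl.
rewrite /hcl (wcountE equiv_gE _ rL) //; apply: eq_big_seq => x xL.
have [_ xD _ _] := rep_systemE equiv_gE rL.
have /primE[[_ Dx] x1] := xD _ xL.
rewrite wt_one // => t t1 e.
  have := content_equiv e; rewrite x1 (_ : (t, 0, t) = scale t (1, 0, 1)); last first.
    by rewrite /scale /fa /fb /fc /= !mulr1 mulr0.
  rewrite content_scale ?mulr1; last by lia.
  by move=> t1'; move: (disc_t0t e); rewrite -t1' Dx; lia.
have := content_equiv e; rewrite x1 (_ : (t, t, t) = scale t (1, 1, 1)); last first.
  by rewrite /scale /fa /fb /fc /= !mulr1.
rewrite content_scale ?mulr1; last by lia.
by move=> t1'; move: (disc_ttt e); rewrite -t1' Dx; lia.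
Qed.

Lemma disc_abs_disc f N : disc_g f = - N%:Z -> disc_abs N.
Proof.
case: f => [[a b] c]; rewrite /disc_g /disc_abs /fa /fb /fc /= => D.
have [k bk] : exists k, b = 2 * k \/ b = 2 * k + 1 by exists (b %/ 2)%Z; lia.
by case: bk D => ->; nia.
Qed.

Lemma Posz_sqr (t : nat) : (t ^ 2)%:Z = t%:Z ^+ 2.
Proof. by rewrite -mulnn PoszM expr2. Qed.

(** Every form is its content [t] times a primitive form of discriminant [-N / t^2], and scaling
    preserves the weight; the admissible [t] are the divisors of the conductor. *)
Lemma HurwitzE N L : (0 < N)%N -> disc_abs N -> rep_system equiv_g (gform (- N%:Z)) L ->
  Hurwitz N = \sum_(x <- L) wt x.
Proof.
move=> N0 NA rL; rewrite -(wcountE equiv_gE wt_equiv rL).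
(* A fixed choice of primitive representatives for each negative discriminant. *)
pose R D : seq form := epsilon (inhabits [::]) (rep_system equiv_g (prim D)).
have RP D : D < 0 -> rep_system equiv_g (prim D) (R D).
  move=> D0; apply: epsilon_spec.
  have [||L' rL' _] := @exists_reduced_reps (prim D) D D0; last by exists L'.
    by move=> x /primE[].
  by move=> x y; apply: prim_equiv.
have tP t : t \in divisors (conductor N) ->
    [/\ (0 < t)%N, N = (N %/ t ^ 2 * t ^ 2)%N & - (N %/ t ^ 2)%:Z < 0].
  move=> td; have t0 : (0 < t)%N.
    by move: td; have [f0 _ _] := conductorP N0 NA; rewrite -dvdn_divisors // => /dvdn_gt0->.
  move: td; rewrite mem_divisors_conductor // => /andP[tN _].
  have e := divnK tN; split => //; rewrite oppr_lt0 ltz_nat.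
  by rewrite divn_gt0 ?expn_gt0 ?t0 // dvdn_leq.
pose r := [seq (t, x) | t <- divisors (conductor N), x <- R (- (N %/ t ^ 2)%:Z)].
pose phi (i : nat * form) := scale i.1%:Z i.2.
have rP t x : (t, x) \in r -> t \in divisors (conductor N) /\ x \in R (- (N %/ t ^ 2)%:Z).
  by move=> /allpairsPdep[t' [x' [? ? []]]] -> ->.
have rD t x : (t, x) \in r -> gform (- (N %/ t ^ 2)%:Z) x /\ content x = 1.
  move=> /rP[/tP[_ _ D0] xR]; apply/primE.
  by have [_ h _ _] := rep_systemE equiv_gE (RP _ D0); apply: h.
rewrite (wcountE equiv_gE wt_equiv (L := map phi r)).
  rewrite big_map big_allpairs_dep /= /Hurwitz; apply: eq_big_seq => t /tP[t0 _ D0].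
  rewrite (hwE D0 (RP _ D0)); apply: eq_bigr => x _.
  by rewrite /phi wt_scale //=; lia.
apply: rep_system_map.
- apply: allpairs_uniq_dep => [|t td|[t x] [t' x'] _ _ [-> ->]] //.
    exact: divisors_uniq.
  by have [_ _ /RP/(rep_systemE equiv_gE)[]] := tP t td.
- move=> [t x] tx; have [[x0 Dx] _] := rD _ _ tx; have [/tP[t0 e _] _] := rP _ _ tx.
  split; first by rewrite /phi /scale /fa /= mulr_gt0 //; lia.
  by rewrite disc_g_scale Dx /= mulrN -Posz_sqr -PoszM mulnC -e.
- move=> f [f0 Df]; have fn0 : f != (0, 0, 0) by apply: contraTneq f0 => ->.
  have [g ef g1] := content_scaleE fn0.
  have [t et] : exists t : nat, content f = t%:Z.
    by exists `|content f|%N; rewrite gez0_abs ?content_ge0.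
  rewrite {}et in ef.
  have t0 : 0 < t%:Z.
    by case: t ef => // ef; move: f0; rewrite ef /scale /fa /= mul0r.
  have g0 : 0 < fa g by move: f0; rewrite ef /scale {1}/fa /= pmulr_rgt0.
  have [k Dg] : exists k : nat, disc_g g = - k%:Z.
    exists `|disc_g g|%N; suff : disc_g g < 0 by lia.
    have : t%:Z ^+ 2 * disc_g g < 0 by rewrite -disc_g_scale -ef Df; lia.
    by rewrite pmulr_rlt0 // exprn_gt0.
  have Nk : N = (k * t ^ 2)%N.
    apply/eqP; rewrite -eqz_nat -eqr_opp -Df ef disc_g_scale Dg PoszM.
    by rewrite mulrN mulrC Posz_sqr.
  have t2 : (0 < t ^ 2)%N by rewrite expn_gt0 -ltz_nat t0.
  have kN : (N %/ t ^ 2)%N = k by rewrite Nk mulnK.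
  have td : t \in divisors (conductor N).
    rewrite mem_divisors_conductor // kN (disc_abs_disc Dg) andbT Nk.
    exact: dvdn_mull.
  have [_ _ D0] := tP t td.
  have [_ _ PR _] := rep_systemE equiv_gE (RP _ D0).
  have [|y yR gy] := PR g; first by apply/primE; split; rewrite // kN.
  exists (t, y); first by apply/allpairsPdep; exists t, y.
  by rewrite {1}ef; apply/equiv_g_scale => //; lia.
(* The content of [t x] is [t], so equivalent multiples have the same [t], which can then be
   cancelled. *)
- move=> [t x] [t' x'] tx tx' e.
  have [_ x1] := rD _ _ tx; have [_ x1'] := rD _ _ tx'.
  have tt' : t = t'.
    by have := content_equiv e; rewrite !content_scale // x1 x1' !mulr1 => -[].
  rewrite -{t'}tt' in tx' e *.
  have [/tP[t0 _ D0] xR] := rP _ _ tx; have [_ xR'] := rP _ _ tx'.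
  have [_ _ _ inj] := rep_systemE equiv_gE (RP _ D0).
  by congr (_, _); apply: inj => //; apply/(@equiv_g_scale t%:Z); first by lia.
Qed.

(** * Even and uneven classical forms *)

Lemma oddzP (x : int) : ~~ (2 %| x)%Z -> exists k, x = 2 * k + 1.
Proof. by move=> x2; exists (x %/ 2)%Z; lia. Qed.

Lemma evenzP (x : int) : (2 %| x)%Z -> exists k, x = 2 * k.
Proof. by move=> x2; exists (x %/ 2)%Z; lia. Qed.

(** The square of the divisor divides [n], and 4 does not; so the divisor is odd, and dividing by it
    preserves parities. *)
Lemma uneven_clE n f : (n %% 4 != 0)%N -> det_cl f = - n%:Z ->
  uneven_cl f = ~~ ((2 %| fa f)%Z && (2 %| fc f)%Z).
Proof.
case: f => [[a b] c] n4; rewrite /det_cl /uneven_cl /divisor_cl /fa /fb /fc /= => D.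
rewrite -[gcdz (gcdz a b) c]/(content (a, b, c)).
have := dvdzz (content (a, b, c)); rewrite [in X in X -> _]dvdz_content.
rewrite /fa /fb /fc /=; move: (content _) => d.
move=> /and3P[/dvdzP[a' ea] /dvdzP[b' eb] /dvdzP[c' ec]].
have d2 : ~~ (2 %| d)%Z.
  apply/negP => /evenzP[k dk].
  move: D; rewrite ea eb ec dk => D.
  have : 4 * (k ^+ 2 * (b' ^+ 2 - a' * c')) = - n%:Z by rewrite -D; ring.
  by lia.
have d0 : d != 0 by lia.
rewrite ea ec !mulzK //.
have [k dk] := oddzP d2.
have par (x : int) : (2 %| x * d)%Z = (2 %| x)%Z.
  by rewrite dk (_ : x * (2 * k + 1) = 2 * (x * k) + x); [lia|ring].
by rewrite !par.
Qed.

Definition clform (n : nat) (f : form) : Prop := posdef_cl f /\ det_cl f = - n%:Z.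

Lemma clform_dbl n f : (0 < n)%N -> clform n f <-> gform (- (4 * n)%:Z) (dbl f).
Proof.
move=> n0; rewrite /clform /posdef_cl /gform disc_g_dbl; split.
  by move=> [/andP[a0 _] ->]; split=> //; lia.
move=> [a0 D]; have -> : det_cl f = - n%:Z by lia.
by split=> //; rewrite a0; lia.
Qed.

Lemma clform_equiv n f g : (0 < n)%N -> clform n f -> equiv_cl f g -> clform n g.
Proof.
move=> n0 /(clform_dbl _ n0) fn /equiv_dbl e; apply/(clform_dbl _ n0).
by apply: gform_equiv fn e; lia.
Qed.

(** With [a] and [c] even, [-n] is congruent to the square [b^2] modulo 4. *)
Lemma evencl_mod4 n f : clform n f -> (2 %| fa f)%Z -> (2 %| fc f)%Z ->
  ((n %% 4 == 0) || (n %% 4 == 3))%N.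
Proof.
case: f => [[a b] c] [_]; rewrite /det_cl /fa /fb /fc /= => D.
move=> /evenzP[a' ea] /evenzP[c' ec]; move: D; rewrite ea ec.
rewrite (_ : 2 * a' * (2 * c') = 4 * (a' * c')); last ring.
have [/evenzP[k ->]|/oddzP[k ->]] := boolP (2 %| b)%Z.
  by rewrite (_ : (2 * k) ^+ 2 = 4 * k ^+ 2); [lia|ring].
by rewrite (_ : (2 * k + 1) ^+ 2 = 4 * (k ^+ 2 + k) + 1); [lia|ring].
Qed.

(** A discriminant divisible by 4 forces an even middle coefficient, so halving that coefficient
    inverts [dbl]; no form is even by [evencl_mod4]. *)
Lemma Fcl_mod12 n L : ((n %% 4 == 1) || (n %% 4 == 2))%N ->
  rep_system equiv_g (gform (- (4 * n)%:Z)) L -> Fcl n = \sum_(x <- L) wt x.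
Proof.
move=> n4 rL; have n0 : (0 < n)%N by lia.
have [uL LP PL inj] := rep_systemE equiv_gE rL.
pose phi (f : form) : form := (fa f, (fb f %/ 2)%Z, fc f).
have phiK f : f \in L -> dbl (phi f) = f.
  move=> /LP[_]; case: f => [[a b] c]; rewrite /phi /disc_g /dbl /fa /fb /fc /= => D.
  congr (_, _, _); have [/evenzP[k ->]|/oddzP[k bk]] := boolP (2 %| b)%Z; first by lia.
  by move: D; rewrite bk (_ : (2 * k + 1) ^+ 2 = 4 * (k ^+ 2 + k) + 1); [lia|ring].
rewrite /Fcl (wcountE equiv_clE weight_cl_equiv (L := map phi L)).
  by rewrite big_map; apply: eq_big_seq => f fL; rewrite weight_clE phiK.
apply: rep_system_map => //.
- move=> f fL; have fn : clform n (phi f) by apply/clform_dbl; rewrite // phiK //; apply: LP.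
  case: (fn) => pd Df; split=> //; split => //; rewrite (uneven_clE _ Df); last by lia.
  by apply/negP => /andP[h1 h2]; have := evencl_mod4 fn h1 h2; lia.
- move=> f [pd [Df _]]; have [|g gL fg] := PL (dbl f); first by apply/clform_dbl.
  by exists g => //; apply/equiv_dbl; rewrite phiK.
- by move=> f g fL gL /equiv_dbl; rewrite !phiK //; apply: inj.
Qed.

Lemma F1cl_mod12 n : ((n %% 4 == 1) || (n %% 4 == 2))%N -> F1cl n = 0.
Proof.
move=> n4; rewrite /F1cl (wcountE equiv_clE weight_cl_equiv (L := [::])) ?big_nil //.
split => // f [pd [Df]]; rewrite (uneven_clE _ Df); last by lia.
rewrite negbK => /andP[h1 h2].
by have := evencl_mod4 (conj pd Df : clform n f) h1 h2; lia.
Qed.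

Lemma F1cl_mod3 n L : (n %% 4 == 3)%N -> rep_system equiv_g (gform (- n%:Z)) L ->
  F1cl n = \sum_(x <- L) wt x.
Proof.
move=> n4 rL; have n0 : (0 < n)%N by lia.
have [uL LP PL inj] := rep_systemE equiv_gE rL.
pose phi (f : form) : form := (2 * fa f, fb f, 2 * fc f).
have phiE f : dbl (phi f) = scale 2 f by [].
rewrite /F1cl (wcountE equiv_clE weight_cl_equiv (L := map phi L)).
  by rewrite big_map; apply: eq_bigr => f _; rewrite weight_clE phiE wt_scale.
apply: rep_system_map => //.
- move=> f /LP[a0 Df]; have fn : clform n (phi f).
    apply/clform_dbl; rewrite // phiE; split; last by rewrite disc_g_scale Df; lia.
    by rewrite /scale /fa /= mulr_gt0.
  case: (fn) => pd Df'; split=> //; split => //; rewrite (uneven_clE _ Df'); last by lia.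
  by rewrite negbK; apply/andP; rewrite /phi /fa /fc /=; split; lia.
- move=> [[a b] c] [pd [Df]]; rewrite (uneven_clE _ Df); last by lia.
  rewrite negbK /fa /fc /= => /andP[/evenzP[a' ea] /evenzP[c' ec]].
  rewrite {}ea {}ec in pd Df *.
  have [|g gL fg] := PL (a', b, c').
    move: pd Df; rewrite /posdef_cl /gform /det_cl /disc_g /fa /fb /fc /= => /andP[a0 _] D.
    by split; [lia|rewrite -D; ring].
  exists g => //; apply/equiv_dbl; rewrite phiE.
  exact/(@equiv_g_scale 2 (a', b, c')).
- by move=> f g fL gL /equiv_dbl; rewrite !phiE equiv_g_scale //; apply: inj.
Qed.

(** A multiple of [x^2 + y^2] would make [n] a square. A multiple [t (x^2 + x y + y^2)] has
    [3 t^2 = 4 n], so [t] is even and both outer coefficients are even. *)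
Lemma weight_uneven n f : (n %% 4 == 3)%N -> clform n f -> uneven_cl f -> weight_cl f = 1.
Proof.
move=> n4 [_ Df]; rewrite (uneven_clE _ Df); last by lia.
move=> une; rewrite weight_clE; apply: wt_one => t t1 e.
  have := disc_t0t e; rewrite disc_g_dbl Df => nt.
  have {nt} nt : n%:Z = t ^+ 2 by lia.
  have [/evenzP[k tk]|/oddzP[k tk]] := boolP (2 %| t)%Z; move: nt; rewrite tk.
    by rewrite (_ : (2 * k) ^+ 2 = 4 * k ^+ 2); [lia|ring].
  by rewrite (_ : (2 * k + 1) ^+ 2 = 4 * (k ^+ 2 + k) + 1); [lia|ring].
have t2 : (2 %| t)%Z.
  apply: contraT => /oddzP[k tk]; have := disc_ttt e; rewrite disc_g_dbl Df tk.
  by rewrite (_ : (2 * k + 1) ^+ 2 = 4 * (k ^+ 2 + k) + 1); [lia|ring].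
have [] := equiv_g_dvd (equiv_g_sym e) t2 t2 t2.
by rewrite /dbl /fa /fc /= => h1 _ h2; move: une; rewrite /fa /fc h1 h2.
Qed.

(** * Uneven forms of determinant [-n] over forms of discriminant [-n] *)

(* [f (2 x, y)], as a classical form: the middle coefficient [2 (fb f)] is halved. *)
Definition up (f : form) : form := (4 * fa f, fb f, fc f).

(** A matrix with even upper right entry preserves the sublattice of vectors with even first
    coordinate. In the basis of that sublattice it becomes [(p, u; 2 r, s)]. *)
Lemma up_act f p u r s : p * s - 2 * u * r = 1 ->
  equiv_cl (up f) (up (act_g f p (2 * u) r s)).
Proof.
case: f => [[a b] c] d; exists p, u, (2 * r), s; split; first by rewrite -[RHS]d; ring.
by congr (_, _, _); rewrite /up /act_g /fa /fb /fc /=; ring.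
Qed.

(** Converse of [up_act]: the leading coefficient [4 a'] of the target is congruent to [c r^2]
    modulo 2 and [c] is odd, so the lower left entry [r] is even. *)
Lemma up_equiv f g : ~~ (2 %| fc f)%Z -> equiv_cl (up f) (up g) ->
  exists p u r s, p * s - 2 * u * r = 1 /\ act_g f p (2 * u) r s = g.
Proof.
case: f g => [[a b] c] [[a' b'] c']; rewrite /up /fa /fb /fc /= => c2.
move=> [p [q [r [s [d]]]]]; rewrite /act_cl /fa /fb /fc /= => -[ea eb ec].
have [/evenzP[k rk]|/oddzP[k rk]] := boolP (2 %| r)%Z; last first.
  have [l cl] := oddzP c2; move: ea; rewrite rk cl.
  rewrite (_ : (2 * l + 1) * (2 * k + 1) ^+ 2 =
    2 * (2 * (2 * l + 1) * (k ^+ 2 + k) + l) + 1); last by ring.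
  rewrite (_ : 2 * b * p * (2 * k + 1) = 2 * (b * p * (2 * k + 1))); last by ring.
  by rewrite -mulrA; lia.
exists p, q, k, s; split; first by rewrite -[RHS]d rk; ring.
rewrite /act_g /fa /fb /fc /=; congr (_, _, _).
- apply: (@mulfI _ 4) => //; rewrite -ea rk; ring.
- by rewrite -eb rk; ring.
- by rewrite -ec; ring.
Qed.

Lemma up_clform n f : (0 < n)%N -> gform (- n%:Z) f -> clform n (up f).
Proof.
move=> n0 [a0 Df]; apply/clform_dbl => //; split.
  by rewrite /dbl /up /fa /= mulr_gt0.
by move: Df; rewrite /disc_g /up /dbl /fa /fb /fc /=; lia.
Qed.

Lemma up_uneven n f : (n %% 4 == 3)%N -> gform (- n%:Z) f -> ~~ (2 %| fc f)%Z ->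
  posdef_cl (up f) /\ det_cl (up f) = - n%:Z /\ uneven_cl (up f).
Proof.
move=> n4 fn c2; have n0 : (0 < n)%N by lia.
have [pd Df] := up_clform n0 fn; split => //; split => //.
rewrite (uneven_clE _ Df); last by lia.
by apply/negP => /andP[_]; rewrite /up /fc /=; apply/negP.
Qed.

(** Once [a] is even and [c] odd, [b] is odd because [n] is, and [a c = b^2 + n] is divisible by 4;
    hence so is [a]. *)
Lemma uneven_up n f : (n %% 4 == 3)%N -> clform n f -> uneven_cl f ->
  exists g, [/\ gform (- n%:Z) g, ~~ (2 %| fc g)%Z & equiv_cl f (up g)].
Proof.
move=> n4 fn; have n0 : (0 < n)%N by lia.
have [pd Df] := fn; rewrite (uneven_clE _ Df); last by lia.
rewrite negb_and => ac2.
(* Modulo 2 the form is [a x^2 + c y^2], nonzero, and it vanishes at one of [(1, 0)], [(0, 1)],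
   [(1, 1)]; this vector is made the first basis vector. *)
have [h [fh ha hc]] : exists h, [/\ equiv_cl f h, (2 %| fa h)%Z & ~~ (2 %| fc h)%Z].
  have ex p q r s : p * s - q * r = 1 -> (2 %| fa (act_cl f p q r s))%Z ->
      ~~ (2 %| fc (act_cl f p q r s))%Z ->
      exists h, [/\ equiv_cl f h, (2 %| fa h)%Z & ~~ (2 %| fc h)%Z].
    by move=> d ha hc; exists (act_cl f p q r s); split=> //; exists p, q, r, s.
  case: f {fn pd Df} ac2 ex => [[a b] c]; rewrite /act_cl /fa /fb /fc /= => ac2 ex.
  have [a2|a2] := boolP (2 %| a)%Z.
    apply: (ex 1 0 0 1) => //; move: ac2; rewrite ?expr0n ?expr1n /=; lia.
  have [c2|c2] := boolP (2 %| c)%Z.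
    by apply: (ex 0 (-1) 1 0) => //; rewrite ?sqrrN ?expr0n ?expr1n /=; lia.
  by apply: (ex 1 0 1 1) => //; rewrite ?expr0n ?expr1n /=; lia.
have hn := clform_equiv n0 fn fh; move: hn ha hc fh.
case: h => [[a b] c] [/andP[a0 _]]; rewrite /det_cl /fa /fb /fc /= in a0 * => D.
move=> /evenzP[k ak] c2 fh; have [l cl] := oddzP c2.
have b2 : ~~ (2 %| b)%Z.
  apply/negP => /evenzP[m bm]; move: D.
  by rewrite ak bm cl (_ : _ - _ = 2 * (2 * m ^+ 2 - k * (2 * l + 1))); [lia|ring].
have [m bm] := oddzP b2.
have k2 : (2 %| k)%Z.
  move: D; rewrite ak bm cl.
  by rewrite (_ : _ - _ = 4 * (m ^+ 2 + m - k * l) + 1 - 2 * k); [lia|ring].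
have [j kj] := evenzP k2; exists (j, b, c); split => //.
  rewrite /gform /disc_g /fa /fb /fc /=; split; first by lia.
  by rewrite -D ak kj; ring.
by move: fh; rewrite /up /fa /fb /fc /= ak kj mulrA.
Qed.

(** * Forms of odd discriminant modulo 2, and the case of 7 modulo 8 *)

Lemma gform_odd n f : (n %% 2 == 1)%N -> gform (- n%:Z) f -> ~~ (2 %| fb f)%Z.
Proof.
case: f => [[a b] c] n2 [_]; rewrite /disc_g /fa /fb /fc /= => D.
apply/negP => /evenzP[k bk]; move: D; rewrite bk.
by rewrite (_ : _ - _ = 4 * (k ^+ 2 - a * c)); [lia|ring].
Qed.

Lemma mul_succ_even (k : int) : exists j, k * (k + 1) = 2 * j.
Proof.
apply: evenzP; have [/evenzP[i ->]|/oddzP[i ->]] := boolP (2 %| k)%Z.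
  by rewrite -mulrA dvdz_mulr.
by rewrite (_ : _ * _ = 2 * ((2 * i + 1) * (i + 1))) ?dvdz_mulr //; ring.
Qed.

(** Odd squares are 1 modulo 8, so [n] modulo 8 decides the parity of [a c]. *)
Lemma gform_ac n f : (n %% 2 == 1)%N -> gform (- n%:Z) f ->
  exists j, 4 * (fa f * fc f) = 8 * j + 1 + n%:Z.
Proof.
move=> n2 fn; have [k bk] := oddzP (gform_odd n2 fn).
case: f fn bk => [[a b] c] [_]; rewrite /disc_g /fa /fb /fc /= => D bk.
have [j kj] := mul_succ_even k.
exists j; rewrite (_ : n%:Z = - (b ^+ 2 - 4 * a * c)); last by rewrite D opprK.
rewrite (_ : 8 * j = 4 * (2 * j)); last by ring.
by rewrite -kj bk; ring.
Qed.

(** Modulo 2 the form is [x^2 + x y + y^2], odd at all three nonzero vectors. *)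
Lemma gform_mod8_3 n f : (n %% 8 == 3)%N -> gform (- n%:Z) f ->
  ~~ (2 %| fa f)%Z /\ ~~ (2 %| fc f)%Z.
Proof.
move=> n8 fn; have [|j] := gform_ac _ fn; first by lia.
move=> D; split; apply/negP => /evenzP[i ei]; move: D; rewrite ei.
  by rewrite -mulrA; lia.
by rewrite mulrCA; lia.
Qed.

(** Modulo 2 the form is a product of two distinct linear forms, so exactly one nonzero vector has
    an odd value. *)
Lemma gform_mod8_7 n f : (n %% 8 == 7)%N -> gform (- n%:Z) f ->
  (2 %| fa f)%Z || (2 %| fc f)%Z.
Proof.
move=> n8 fn; have [|j D] := gform_ac _ fn; first by lia.
apply: contraT; rewrite negb_or => /andP[/oddzP[i ai] /oddzP[l cl]].
move: D; rewrite ai cl.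
by rewrite (_ : (2 * i + 1) * (2 * l + 1) = 2 * (2 * (i * l) + i + l) + 1); [lia|ring].
Qed.

(** With [b] odd, one of the values [c], [a], [a + b + c] at the nonzero vectors modulo 2 is odd;
    the vector is moved to [(0, 1)], where [fc] is the value. *)
Lemma exists_fc_odd f : ~~ (2 %| fb f)%Z ->
  exists2 g, equiv_g f g & ~~ (2 %| fc g)%Z.
Proof.
case: f => [[a b] c]; rewrite {1}/fb /= => b2.
have [c2|c2] := boolP (2 %| c)%Z; last by exists (a, b, c) => //; apply: equiv_g_refl.
have [a2|a2] := boolP (2 %| a)%Z.
  exists (act_g (a, b, c) 1 1 0 1); first by apply: equiv_g_act.
  by rewrite /act_g /fa /fb /fc /= !expr1n; lia.
exists (act_g (a, b, c) 0 (-1) 1 0); first by apply: equiv_g_act.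
by rewrite /act_g /fa /fb /fc /= sqrrN expr0n expr1n /=; lia.
Qed.

(** Each class has a single vector of odd value modulo 2, hence a single uneven restriction, and
    uneven forms have weight 1. *)
Lemma Fcl_mod8_7 n L : (n %% 8 == 7)%N -> rep_system equiv_g (gform (- n%:Z)) L ->
  Fcl n = (size L)%:R.
Proof.
move=> n8 rL; have n0 : (0 < n)%N by lia.
have n4 : (n %% 4 == 3)%N by lia.
have n2 : (n %% 2 == 1)%N by lia.
have D0 : - n%:Z < 0 by lia.
have [uL LP PL inj] := rep_systemE equiv_gE rL.
pose oddc f := epsilon (inhabits f) (fun g => equiv_g f g /\ ~~ (2 %| fc g)%Z).
have oddcP f : f \in L -> equiv_g f (oddc f) /\ ~~ (2 %| fc (oddc f))%Z.
  move=> /LP fn; apply: (epsilon_spec (inhabits f) (fun g => equiv_g f g /\ ~~ (2 %| fc g)%Z)).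
  by have [g fg c2] := exists_fc_odd (gform_odd n2 fn); exists g.
have oddcn f : f \in L -> gform (- n%:Z) (oddc f).
  by move=> fL; have [e _] := oddcP f fL; apply: gform_equiv (LP _ fL) e.
rewrite /Fcl (wcountE equiv_clE weight_cl_equiv (L := map (up \o oddc) L)).
  rewrite big_map (eq_big_seq (fun=> 1)); first by rewrite big_const_seq count_predT iter_addr_0.
  move=> f fL; have [_ c2] := oddcP f fL.
  have [pd [Df une]] := up_uneven n4 (oddcn f fL) c2.
  by apply: (@weight_uneven n).
apply: rep_system_map => //.
- by move=> f fL; have [_ c2] := oddcP f fL; apply: up_uneven => //; apply: oddcn.
- move=> f [pd [Df une]].
  have [g [gn c2 fg]] := uneven_up n4 (conj pd Df) une.
  have [h hL gh] := PL g gn; exists h => //; apply: equiv_cl_trans fg _.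
  have [e hc2] := oddcP h hL.
  have [p [q [r [s [d E]]]]] := equiv_g_trans gh e.
  have hn := oddcn h hL; have a2 := gform_mod8_7 n8 gn; have b2 := gform_odd n2 gn.
  have a2' := gform_mod8_7 n8 hn.
  suff /evenzP[u qu] : (2 %| q)%Z.
    by rewrite /= -E qu; apply: up_act; rewrite -[RHS]d qu; ring.
  move: a2 b2 c2 hc2; rewrite -E; case: (g) => [[a b] c].
  rewrite /act_g /fa /fb /fc /= => a2 b2 c2 hc2.
  (* An equivalence must carry the odd vector [(0, 1)] to the odd vector [(0, 1)] modulo 2. Indeed,
     with [a] even and [b], [c], [q] odd, the new [fc] is congruent to [s + s^2], which is even. *)
  apply: contraT => /oddzP[k qk].
  have [i ai] : exists i, a = 2 * i by apply: evenzP; move: a2; rewrite (negPf c2) orbF.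
  have [j bj] := oddzP b2; have [l cl] := oddzP c2.
  case/negP: hc2; rewrite qk ai bj cl.
  have [/evenzP[m ->]|/oddzP[m ->]] := boolP (2 %| s)%Z.
    rewrite (_ : _ + _ = 2 * (i * (2 * k + 1) ^+ 2 + (2 * j + 1) * (2 * k + 1) * m
      + 2 * (2 * l + 1) * m ^+ 2)); first exact: dvdz_mulr.
    by ring.
  rewrite (_ : _ + _ = 2 * (i * (2 * k + 1) ^+ 2 + (2 * j + 1) * (2 * k * m + k + m) + j
      + (2 * l + 1) * 2 * (m ^+ 2 + m) + l + 1)); first exact: dvdz_mulr.
  by ring.
- move=> f g fL gL /=.
  have [ef cf] := oddcP f fL; have [eg cg] := oddcP g gL.
  move=> /(up_equiv cf)[p [u [r [s [d E]]]]]; apply: inj => //.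
  apply: equiv_g_trans ef (equiv_g_trans _ (equiv_g_sym eg)).
  by exists p, (2 * u), r, s.
Qed.

(** * Automorphs, the three sublattices of index 2, and the case of 3 modulo 8 *)

Lemma reduced_ttt f t : 1 <= t -> reduced f -> 0 < fa f -> equiv_g f (t, t, t) -> f = (t, t, t).
Proof.
move=> t1 rf f0 e.
have ttt : (t, t, t) = scale t (1, 1, 1) by rewrite /scale /fa /fb /fc /= mulr1.
have f00 : f != (0, 0, 0) by apply: contraTneq f0 => ->.
have [g fg g1] := content_scaleE f00.
have ct : content f = t by rewrite (content_equiv e) ttt content_scale ?mulr1 //; lia.
rewrite ct in fg; rewrite fg ttt; congr scale; apply: reduced_disc3.
  split; first by move: f0; rewrite fg /scale {1}/fa /= pmulr_rgt0 //; lia.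
  have /(@mulfI _ (t ^+ 2)) : t ^+ 2 != 0 by rewrite expf_neq0 //; lia.
  by apply; rewrite -disc_g_scale -fg (disc_ttt e); ring.
move: rf; rewrite fg /reduced /scale; case: (g) => [[a b] c]; rewrite /fa /fb /fc /=.
have t0 : 0 < t by lia.
by rewrite -mulrN ltr_pM2l // !ler_pM2l.
Qed.

(** The only proper automorphs are plus and minus the identity. A solution with [r] nonzero would
    force [a = c] and [b] among [0], [a], [-a], each excluded by parity, by the exceptional form, or
    by reduction. *)
Lemma reduced_automorph x p q r s : reduced x -> 0 < fa x -> ~~ (2 %| fb x)%Z ->
  ~~ ((fa x == fb x) && (fb x == fc x)) -> p * s - q * r = 1 ->
  act_g x p q r s = x -> q = 0 /\ r = 0.
Proof.
case: x => [[a b] c]; rewrite /reduced /act_g /fa /fb /fc /=.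
move=> /and3P[h1 h2 h3] a0 b2 ns d [e1 e2 _].
(* With [X] the Gram matrix and [g] the substitution, [g^T X g = X] is used in the form
   [g^T X = X g^-1], which is linear in the entries of [g]. *)
have k1 : 2 * a * s - b * r = 2 * a * p + b * r.
  transitivity (2 * (a * p ^+ 2 + b * p * r + c * r ^+ 2) * s -
    (2 * a * p * q + b * (p * s + q * r) + 2 * c * r * s) * r); first by rewrite e1 e2.
  transitivity ((2 * a * p + b * r) * (p * s - q * r)); first by ring.
  by rewrite d mulr1.
have k2 : - 2 * a * q + b * p = b * p + 2 * c * r.
  transitivity (- 2 * (a * p ^+ 2 + b * p * r + c * r ^+ 2) * q +
    (2 * a * p * q + b * (p * s + q * r) + 2 * c * r * s) * p); first by rewrite e1 e2.
  transitivity ((b * p + 2 * c * r) * (p * s - q * r)); first by ring.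
  by rewrite d mulr1.
have {}k1 : a * (s - p) = b * r by lia.
have {}k2 : a * q = - (c * r) by lia.
have [r0|r0] := eqVneq r 0.
  split => //; move: k2; rewrite r0 mulr0 oppr0 => /eqP.
  by rewrite mulf_eq0 => /orP[/eqP|/eqP //]; lia.
exfalso.
have sp : (s - p) ^+ 2 <= r ^+ 2.
  have : a ^+ 2 * (s - p) ^+ 2 <= a ^+ 2 * r ^+ 2.
    rewrite -exprMn k1 exprMn ler_wpM2r ?sqr_ge0 //; nia.
  by rewrite ler_pM2l // exprn_gt0.
have qr : r ^+ 2 <= - (q * r).
  have c0 : 0 <= c - a by lia.
  have : a * r ^+ 2 <= a * - (q * r).
    have -> : a * - (q * r) = - (a * q) * r by ring.
    by rewrite k2 opprK -mulrA -expr2 ler_wpM2r ?sqr_ge0.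
  by rewrite ler_pM2l.
(* As [(s + p)^2 >= 0], the two bounds above yield [3 r^2 <= 4], hence [r^2 = 1] and then
   [q r = -1]. *)
have tr : (s - p) ^+ 2 = (s + p) ^+ 2 - 4 - 4 * (q * r).
  transitivity ((s + p) ^+ 2 - 4 * (p * s - q * r) - 4 * (q * r)); first by ring.
  by rewrite d mulr1.
have tr0 := sqr_ge0 (s + p).
have r1 : r ^+ 2 = 1.
  have : 0 < r ^+ 2 by rewrite exprn_even_gt0.
  lia.
have qr1 : q * r = -1 by lia.
have sp1 : (s - p) ^+ 2 <= 1 by lia.
have rE : r = 1 \/ r = -1.
  by move/eqP: r1; rewrite sqrf_eq1 => /orP[] /eqP ->; [left|right].
have qE : q = - r by case: rE => e; move: qr1; rewrite e; lia.
have ca : c = a by case: rE => e; move: k2; rewrite qE e; lia.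
have bE : b = a \/ b = - a \/ b = 0.
  have spE : s - p = 0 \/ s - p = 1 \/ s - p = -1 by nia.
  by case: rE => er; case: spE k1 => [->|[->|->]]; rewrite er; lia.
case: bE => [ba|[ba|b0]]; [|lia|by move: b2; rewrite b0].
by move: ns; rewrite ba ca !eqxx.
Qed.

(* The second column [k] modulo 2 determines the coset [g Gamma], [Gamma] being the group of
   matrices with even upper right entry; [(k.2, k.1; k.2 - 1, k.2)] represents it. *)
Definition gcol (x : form) (k : int * int) : form := act_g x k.2 k.1 (k.2 - 1) k.2.

(** The three nonzero vectors modulo 2, one for each sublattice of index 2; [(0, 1)] gives the
    identity matrix. *)
Definition cols : seq (int * int) := [:: (0, 1); (1, 1); (1, 0)].

(** One column for each orbit of the automorphs of [x]: those of a multiple of [x^2 + x y + y^2]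
    permute the three columns cyclically. *)
Definition orbit_cols (x : form) : seq (int * int) :=
  if (fa x == fb x) && (fb x == fc x) then [:: (0, 1)] else cols.

Lemma orbit_cols_sub x : {subset orbit_cols x <= cols}.
Proof. by rewrite /orbit_cols; case: ifP => _ k //; rewrite !inE => ->. Qed.

Lemma gcol_equiv x k : k \in cols -> equiv_g x (gcol x k).
Proof. by rewrite !inE => /or3P[] /eqP->; apply: equiv_g_act. Qed.

(** The inverse of the matrix of [gcol], multiplied by [(p, q; r, s)], has upper right entry
    [k.2 * q - k.1 * s]. When it is even, the two matrices lie in the same coset and [up_act]
    applies. *)
Lemma up_gcol x k p q r s : k \in cols -> p * s - q * r = 1 ->
  (2 %| k.2 * q - k.1 * s)%Z -> equiv_cl (up (gcol x k)) (up (act_g x p q r s)).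
Proof.
case: k => i j /= kc d /evenzP[u qu].
have k1 : j * j - i * (j - 1) = 1 by move: kc; rewrite !inE => /or3P[] /eqP[-> ->].
have -> : act_g x p q r s = act_g (gcol x (i, j)) (j * p - i * r) (2 * u)
    (- (j - 1) * p + j * r) (- (j - 1) * q + j * s).
  rewrite -qu /gcol act_g_comp /=; congr act_g.
  - by transitivity ((j * j - i * (j - 1)) * p); [rewrite k1 mul1r|ring].
  - by transitivity ((j * j - i * (j - 1)) * q); [rewrite k1 mul1r|ring].
  - by transitivity ((j * j - i * (j - 1)) * r); [rewrite k1 mul1r|ring].
  - by transitivity ((j * j - i * (j - 1)) * s); [rewrite k1 mul1r|ring].
apply: up_act; rewrite -qu.
transitivity ((j * j - i * (j - 1)) * (p * s - q * r)); first by ring.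
by rewrite k1 d.
Qed.

Lemma up_orbit x p q r s : p * s - q * r = 1 ->
  exists2 k, k \in orbit_cols x & equiv_cl (up (gcol x k)) (up (act_g x p q r s)).
Proof.
move=> d; rewrite /orbit_cols; case: ifP => [/andP[/eqP ab /eqP bc]|_].
  exists (0, 1); first by rewrite mem_head.
  have c0 : (0, 1) \in cols by rewrite mem_head.
  (* [x] is invariant under the substitution of order 6 with columns [(0, 1)] and [(-1, 1)]. *)
  have rot p' q' r' s' : act_g x (- r') (- s') (p' + r') (q' + s') = act_g x p' q' r' s'.
    by rewrite /act_g -bc -ab; congr (_, _, _); ring.
  (* The rotation turns the upper right entry [q] into [-s], and a second one turns it into
     [-(q + s)]; since [q] and [s] are not both even, exactly one of the three is even. *)
  have [q2|q2] := boolP (2 %| q)%Z; first by apply: up_gcol => //=; lia.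
  have [s2|s2] := boolP (2 %| s)%Z.
    by rewrite -rot; apply: up_gcol => //=; [rewrite -[RHS]d; ring|lia].
  by rewrite -rot -rot; apply: up_gcol => //=; [rewrite -[RHS]d; ring|lia].
have [q2|q2] := boolP (2 %| q)%Z.
  by exists (0, 1); [|apply: up_gcol => //=; lia].
have [s2|s2] := boolP (2 %| s)%Z.
  by exists (1, 0); [|apply: up_gcol => //=; lia].
by exists (1, 1); [|apply: up_gcol => //=; lia].
Qed.

(** An equivalence produces an automorph of [x] that sends the column [k'] to [k] modulo 2. It is
    diagonal of determinant 1, hence the identity modulo 2. *)
Lemma up_orbit_inj x k k' : reduced x -> 0 < fa x -> ~~ (2 %| fb x)%Z ->
  k \in orbit_cols x -> k' \in orbit_cols x ->
  ~~ (2 %| fc (gcol x k))%Z -> equiv_cl (up (gcol x k)) (up (gcol x k')) -> k = k'.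
Proof.
rewrite /orbit_cols => rx x0 b2.
case: ifP => [_|/negbT ns]; first by rewrite !inE => /eqP-> /eqP->.
case: k k' => [i j] [i' j'] kc kc' c2 /(up_equiv c2)[p [u [r [s [d]]]]].
rewrite /gcol act_g_comp /= => E.
have [k1 k1'] : j * j - i * (j - 1) = 1 /\ j' * j' - i' * (j' - 1) = 1.
  by move: kc kc'; rewrite !inE => /or3P[] /eqP[-> ->] /or3P[] /eqP[-> ->].
(* Undoing the matrix of [k'] on both sides yields the automorph of [x]. *)
have := congr1 (fun f => act_g f j' (- i') (- (j' - 1)) j') E.
rewrite !act_g_comp [in RHS](_ : act_g _ _ _ _ _ = act_g x 1 0 0 1); last first.
  by rewrite -[in RHS]k1'; congr act_g; ring.
rewrite act_g1 => /(reduced_automorph rx x0 b2 ns)[].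
  transitivity ((j * j - i * (j - 1)) * (p * s - 2 * u * r) * (j' * j' - i' * (j' - 1))).
    by ring.
  by rewrite k1 k1' d.
have [s' sE] : exists s', s = 2 * s' + 1.
  apply: oddzP; apply/negP => /evenzP[m sm]; move: d; rewrite sm.
  by rewrite (_ : _ - _ = 2 * (p * m - u * r)); [lia|ring].
have [p' pE] : exists p', p = 2 * p' + 1.
  apply: oddzP; apply/negP => /evenzP[m pm]; move: d; rewrite pm.
  by rewrite (_ : _ - _ = 2 * (m * s - u * r)); [lia|ring].
by move: kc kc'; rewrite !inE => /or3P[] /eqP[-> ->] /or3P[] /eqP[-> ->] //; lia.
Qed.

(** Uneven classes correspond to pairs of a form [x] and a column in [orbit_cols x], each of weight
    1: three columns where [wt x = 1], one where [wt x = 1/3]. *)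
Lemma Fcl_mod8_3 n L : (n %% 8 == 3)%N -> rep_system equiv_g (gform (- n%:Z)) L ->
  {in L, forall x, reduced x} -> Fcl n = 3%:R * \sum_(x <- L) wt x.
Proof.
move=> n8 rL Lred; have n0 : (0 < n)%N by lia.
have n4 : (n %% 4 == 3)%N by lia.
have n2 : (n %% 2 == 1)%N by lia.
have D0 : - n%:Z < 0 by lia.
have [uL LP PL inj] := rep_systemE equiv_gE rL.
pose r := [seq (x, k) | x <- L, k <- orbit_cols x].
pose phi (i : form * (int * int)) := up (gcol i.1 i.2).
have rP x k : (x, k) \in r -> x \in L /\ k \in orbit_cols x.
  by move=> /allpairsPdep[x' [k' [? ? []]]] -> ->.
have rn x k : (x, k) \in r -> gform (- n%:Z) (gcol x k).
  move=> /rP[xL /orbit_cols_sub kc]; apply: gform_equiv (LP _ xL) _ => //.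
  exact: gcol_equiv.
have rc x k : (x, k) \in r -> ~~ (2 %| fc (gcol x k))%Z.
  by move=> /rn /(gform_mod8_3 n8)[].
have phiP i : i \in r -> posdef_cl (phi i) /\ det_cl (phi i) = - n%:Z /\ uneven_cl (phi i).
  by case: i => x k xk; apply: up_uneven => //; [apply: rn|apply: rc].
rewrite /Fcl (wcountE equiv_clE weight_cl_equiv (L := map phi r)).
  rewrite big_map (eq_big_seq (fun=> 1)); last first.
    by move=> i /phiP[pd [Df une]]; apply: (@weight_uneven n).
  rewrite big_allpairs_dep mulr_sumr; apply: eq_big_seq => x xL.
  rewrite big_const_seq count_predT iter_addr_0 /orbit_cols.
  have [x0 Dx] := LP _ xL.
  case: ifP => [/andP[/eqP ab /eqP bc]|ns].
    have xE : (fa x, fa x, fa x) = x.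
      by case: (x) ab bc => [[a b] c]; rewrite /fa /fb /fc /= => -> ->.
    rewrite (@wt_third x (fa x)); first by rewrite mul1r mulfV.
      by lia.
    by rewrite xE; apply: equiv_g_refl.
  (* A reduced form equivalent to [(t, t, t)] equals it, contrary to [ns]; [(t, 0, t)] would give
     [n = 4 t^2], but [n] is odd. *)
  rewrite wt_one //= => t t1 e; last first.
    by move: ns; rewrite (reduced_ttt t1 (Lred _ xL) x0 e) /fa /fb /fc /= !eqxx.
  by have := disc_t0t e; rewrite Dx; lia.
apply: rep_system_map.
- apply: allpairs_uniq_dep => // [x xL|[x k] [x' k'] _ _ [-> ->]] //.
  by rewrite /orbit_cols; case: ifP.
- by move=> i /phiP.
- move=> f [pd [Df une]].
  have [g [gn c2 fg]] := uneven_up n4 (conj pd Df) une.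
  have [x xL gx] := PL g gn.
  have [p [q [r' [s [d gE]]]]] := equiv_g_sym gx.
  have [k kc e] := up_orbit x d.
  exists (x, k); first by apply/allpairsPdep; exists x, k.
  by apply: equiv_cl_trans fg (equiv_cl_sym _); rewrite -gE.
- move=> [x k] [x' k'] xk xk' e.
  have c2 := rc _ _ xk; have [xL kc] := rP _ _ xk; have [xL' kc'] := rP _ _ xk'.
  have xx' : x = x'.
    apply: inj => //; have [p [u [t [s [d E]]]]] := up_equiv c2 e.
    apply: (equiv_g_trans (gcol_equiv x (orbit_cols_sub kc))).
    apply: equiv_g_trans (equiv_g_sym (gcol_equiv x' (orbit_cols_sub kc'))).
    by exists p, (2 * u), t, s.
  rewrite -{x'}xx' in xk' xL' kc' e *; congr (_, _).
  have [x0 _] := LP _ xL.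
  exact: up_orbit_inj (Lred _ xL) x0 (gform_odd n2 (LP _ xL)) kc kc' c2 e.
Qed.

(** * The three residue classes of [n] *)

Theorem theorem3 (n : nat) (hn : (1 <= n)%N) (hn4 : (n %% 4 != 0)%N) :
  [/\ ((n %% 4 == 1)%N || (n %% 4 == 2)%N) -> Efun n = Hurwitz (4 * n),
      (n %% 8 == 3)%N -> Efun n = 2%:R * Hurwitz n
    & (n %% 8 == 7)%N -> Efun n = 0].
Proof.
have reps N : (0 < N)%N -> exists2 L,
    rep_system equiv_g (gform (- N%:Z)) L & {in L, forall x, reduced x}.
  move=> N0; have D0 : - N%:Z < 0 by lia.
  by apply: (exists_reduced_reps D0) => // x y; apply: gform_equiv.
split=> n4.
- have [|L rL _] := reps (4 * n)%N; first by lia.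
  rewrite /Efun (Fcl_mod12 n4 rL) F1cl_mod12 // subr0.
  by rewrite (HurwitzE _ _ rL) // /disc_abs; lia.
- have [//|L rL Lred] := reps n; have n43 : (n %% 4 == 3)%N by lia.
  rewrite /Efun (Fcl_mod8_3 n4 rL Lred) (F1cl_mod3 n43 rL).
  rewrite (HurwitzE _ _ rL) // /disc_abs; last by lia.
  by ring.
- have [//|L rL _] := reps n; have n43 : (n %% 4 == 3)%N by lia.
  have [_ LP _ _] := rep_systemE equiv_gE rL.
  rewrite /Efun (Fcl_mod8_7 n4 rL) (F1cl_mod3 n43 rL) (eq_big_seq (fun=> 1)).
    by rewrite big_const_seq count_predT iter_addr_0 subrr.
  (* No exceptional class occurs: [4 t^2] is even, and [3 t^2] is 0 modulo 4 or 3 modulo 8, so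
     neither can be [n]. *)
  move=> x /LP[_ Dx]; apply: wt_one => t t1 e.
    by have := disc_t0t e; rewrite Dx; lia.
  have := disc_ttt e; rewrite Dx.
  have [/evenzP[k ->]|/oddzP[k ->]] := boolP (2 %| t)%Z.
    by rewrite (_ : (2 * k) ^+ 2 = 4 * k ^+ 2); [lia|ring].
  have [j kj] := mul_succ_even k.
  have -> : (2 * k + 1) ^+ 2 = 4 * (k * (k + 1)) + 1 by ring.
  by rewrite kj; lia.
Qed.
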